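(* Let $N$ be a finite set and let $A,B,C$ be pairwise disjoint subsets of $N$. Then the fiber $\mathcal{F}_{\langle A,B|C\rangle}$ of all representations of $u_{\langle A,B|C\rangle}$ is connected by two-by-two basic relations; that is, for any two representations $\theta,\theta'\in\mathcal{F}_{\langle A,B|C\rangle}$ there is a finite sequence $\theta=\theta_0,\theta_1,\dots,\theta_K=\theta'$ of elements of $\mathcal{F}_{\langle A,B|C\rangle}$ such that $\theta_{k-1}$ and $\theta_k$ are adjacent for every $1\le k\le K$.
   Context: Union of sets is written by juxtaposition ($AB=A\cup B$) and a singleton $\{a\}$ is written $a$. For pairwise disjoint $A,B,C\subseteq N$ the semi-elementary imset $u_{\langle A,B|C\rangle}:\mathcal{P}(N)\to\mathbb{Z}$ is the function $u_{\langle A,B|C\rangle}=\delta_{ABC}+\delta_{C}-\delta_{AC}-\delta_{BC}$, where $\delta_S$ is the indicator function of the point $S\in\mathcal{P}(N)$. If $A=a$, $B=b$ are singletons it is called an elementary imset. Let $\mathcal{E}_{\langle A,B|C\rangle}=\{u_{\langle a,b|\Gamma\rangle}\mid a\in A,\ b\in B,\ C\subseteq\Gamma\subseteq ABC\setminus\{a,b\}\}$. A representation of $u_{\langle A,B|C\rangle}$ is a vector $\theta=(\theta_u)_{u\in\mathcal{E}_{\langle A,B|C\rangle}}$ of non-negative integers with $u_{\langle A,B|C\rangle}=\sum_{u\in\mathcal{E}_{\langle A,B|C\rangle}}\theta_u\,u$ as functions on $\mathcal{P}(N)$. The set of all representations is the fiber $\mathcal{F}_{\langle A,B|C\rangle}$.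 A two-by-two basic relation is one of the identities $$u_{\langle a,b_1|\Gamma\rangle}+u_{\langle a,b_2|b_1\Gamma\rangle}=u_{\langle a,b_2|\Gamma\rangle}+u_{\langle a,b_1|b_2\Gamma\rangle}$$ with $a\in A$, distinct $b_1,b_2\in B$, $C\subseteq\Gamma\subseteq ABC\setminus\{a,b_1,b_2\}$, or $$u_{\langle a_1,b|\Gamma\rangle}+u_{\langle a_2,b|a_1\Gamma\rangle}=u_{\langle a_2,b|\Gamma\rangle}+u_{\langle a_1,b|a_2\Gamma\rangle}$$ with distinct $a_1,a_2\in A$, $b\in B$, $C\subseteq\Gamma\subseteq ABC\setminus\{a_1,a_2,b\}$. The difference of the two sides (in either order), regarded as an integer coefficient vector indexed by $\mathcal{E}_{\langle A,B|C\rangle}$ (with two entries $+1$, two entries $-1$, and the rest $0$), is a two-by-two move. Two representations $\theta,\theta'\in\mathcal{F}_{\langle A,B|C\rangle}$ are adjacent if $\theta-\theta'$ is a two-by-two move. *)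

(* Defs.v *)
From HB Require Import structures.
From mathcomp Require Import all_boot all_order all_algebra finmap.

Set Implicit Arguments.
Unset Strict Implicit.
Unset Printing Implicit Defensive.

Import GRing.Theory.
Local Open Scope ring_scope.

Definition imsetType (N : finType) := {ffun {set N} -> int}.

Definition delta (N : finType) (S : {set N}) : imsetType N :=
  [ffun T => (T == S)%:R].

(* Meaningful only for pairwise disjoint A, B, C; total here. *)
Definition semielem (N : finType) (A B C : {set N}) : imsetType N :=
  delta (A :|: B :|: C) + delta C - delta (A :|: C) - delta (B :|: C).

Definition elem (N : finType) (a b : N) (G : {set N}) : imsetType N :=
  semielem [set a] [set b] G.

(* A set of imsets, not of triples (a, b, G): triples giving the same function
   are identified. *)
Definition elems (N : finType) (A B C : {set N}) : {fset imsetType N} :=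
  [fset elem t.1.1 t.1.2 t.2 | t : N * N * {set N} &
    [&& t.1.1 \in A, t.1.2 \in B, C \subset t.2 &
        t.2 \subset (A :|: B :|: C) :\: [set t.1.1; t.1.2]]]%fset.

Definition coefs (N : finType) (A B C : {set N}) := {ffun elems A B C -> nat}.

Definition fiber (N : finType) (A B C : {set N}) : pred (coefs A B C) :=
  [pred th : coefs A B C | semielem A B C == \sum_(u : elems A B C) fsval u *+ th u].
Arguments fiber {N} A B C.

(* Basis vector of Z^(elems A B C) indexed by w; it is 0 if w is not in
   elems A B C, which does not occur for the imsets in the relations below. *)
Definition unitvec (N : finType) (A B C : {set N}) (w : imsetType N) :
    {ffun elems A B C -> int} :=
  [ffun u => (fsval u == w)%:R].

(* Coefficient vector of (left side) - (right side) of a basic relation. *)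
Inductive basic_diff (N : finType) (A B C : {set N}) :
    {ffun elems A B C -> int} -> Prop :=
| BasicDiffB (a b1 b2 : N) (G : {set N}) of
    a \in A & b1 \in B & b2 \in B & b1 != b2 & C \subset G &
    G \subset (A :|: B :|: C) :\: [set a; b1; b2] :
    basic_diff (unitvec A B C (elem a b1 G) + unitvec A B C (elem a b2 (b1 |: G))
      - (unitvec A B C (elem a b2 G) + unitvec A B C (elem a b1 (b2 |: G))))
| BasicDiffA (a1 a2 b : N) (G : {set N}) of
    a1 \in A & a2 \in A & a1 != a2 & b \in B & C \subset G &
    G \subset (A :|: B :|: C) :\: [set a1; a2; b] :
    basic_diff (unitvec A B C (elem a1 b G) + unitvec A B C (elem a2 b (a1 |: G))
      - (unitvec A B C (elem a2 b G) + unitvec A B C (elem a1 b (a2 |: G)))).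

Definition two_by_two_move (N : finType) (A B C : {set N})
    (d : {ffun elems A B C -> int}) : Prop :=
  basic_diff d \/ basic_diff (- d).

Definition adjacent (N : finType) (A B C : {set N}) (th th' : coefs A B C) :
    Prop :=
  two_by_two_move [ffun u => (th u)%:Z - (th' u)%:Z].

(* Main.v *)
(* Write m = |A| and n = |B|.  Since every u_<a,b|Gamma> is a tensor product of
   an edge of the cube of subsets of A and an edge of the cube of subsets of B,
   a representation is an m x n array of cells: for each i < m the cells whose
   A-edge starts at a set of size i form a unit flow in the cube of B, hence a
   maximal chain (the i-th row, an ordering of B), and likewise each j < n gives
   a maximal chain of subsets of A (the j-th column).  Comparing coefficients at
   a set of bidegree (i, j) shows that consecutive columns agree at level i or
   consecutive rows agree at level j.

   The i-th row may be changed at a level where the neighbouring columns use the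
   same A-edge, and symmetrically.  If all columns from the (k+1)-st on are
   equal, then the rows are free above level k+1, so they can be completed there
   by a choice depending only on their set at that level; after this, each of
   those columns can be turned into the k-th one.  Descending to k = 0 makes all
   columns equal; then all rows, and after them all columns, can be made equal
   to a fixed ordering, so every representation is linked to the same one. *)
Require Import Defs.
From HB Require Import structures.
From mathcomp Require Import all_boot all_order all_algebra finmap.
From mathcomp Require Import zify.
From Stdlib Require Import Relation_Operators.

Set Implicit Arguments.
Unset Strict Implicit.
Unset Printing Implicit Defensive.

Import Num.Theory GRing.Theory.

(** * Reordering a single column by exchanges of neighbouring elements *)

Section Column.

Variables (N : finType) (V : nmodType) (E : Type) (R : V -> V -> Prop).
Hypothesis Rxx : forall u, R u u.
Hypothesis Rtrans : forall u v w, R u v -> R v w -> R u w.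
Hypothesis RDl : forall w u v, R u v -> R (w + u)%R (w + v)%R.

Variables (A : {set N}) (g : N -> {set N} -> E -> V) (valid : E -> Prop).
Hypothesis swap : forall (S : {set N}) x y e,
  x \in A -> y \in A -> x != y -> S \subset A -> x \notin S -> y \notin S ->
  valid e -> R (g x S e + g y (x |: S) e)%R (g y S e + g x (y |: S) e)%R.

Definition extends (S : {set N}) (s : seq N) :=
  [&& uniq s, S \subset A & all [pred z | (z \in A) && (z \notin S)] s].

Lemma extends_cons S x s : extends S (x :: s) ->
  [/\ x \in A, x \notin S, S \subset A, x \notin s & extends (x |: S) s].
Proof.
case/and3P=> /= /andP[xs us] sSA /andP[/andP[xA xS] /allP As]; split=> //.
apply/and3P; split=> //; first by rewrite subUset sub1set xA.
apply/allP=> z zs; have /andP[zA zS] := As z zs.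
rewrite /= zA !inE negb_or zS andbT /=.
by apply: contraNneq xs => <-.
Qed.

Lemma extends_perm S s t : perm_eq s t -> extends S s -> extends S t.
Proof.
by move=> p /and3P[us sS As]; rewrite /extends -(perm_uniq p) -(perm_all _ p) us sS.
Qed.

(** Here [f k] stands for the edge of the other cube with which the [k]-th step of the chain is
    paired. An exchange at levels [k] and [k + 1] requires these two edges to coincide. *)
Fixpoint column (S : {set N}) (s : seq N) (f : nat -> E) : V :=
  if s is x :: s' then (g x S (f 0) + column (x |: S) s' (fun k => f k.+1))%R else 0%R.

Lemma column_sum x0 S s f : column S s f =
  (\sum_(i < size s) g (nth x0 s i) (S :|: [set z in take i s]) (f i))%R.
Proof.
elim: s S f => [|x s IH] S f /=; first by rewrite big_ord0.
rewrite big_ord_recl /= IH set_nil setU0; congr (_ + _)%R.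
by apply: eq_bigr => i _; rewrite /= set_cons setUA (setUC S).
Qed.

(** The element [y] passes those of [s1] one at a time, starting with the last; [swap] applies since
    both levels involved carry the same edge. *)
Lemma column_bubble S s1 y s2 f : extends S (s1 ++ y :: s2) ->
  (forall k, k < size s1 -> f k = f k.+1) ->
  (forall k, k <= size s1 -> valid (f k)) ->
  R (column S (s1 ++ y :: s2) f) (column S (y :: s1 ++ s2) f).
Proof.
elim: s1 S f => [|x s1 IH] S f ext eqf vf; first exact: Rxx.
have [xA xS SA /= xs ext'] := extends_cons ext.
have [yA yS yx _] : [/\ y \in A, y \notin x |: S, x |: S \subset A & true].
  case/and3P: ext' => _ sub /allP/(_ y).
  by rewrite mem_cat mem_head orbT => /(_ isT)/andP[].
move: yS; rewrite !inE negb_or => /andP[neq_yx yS].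
apply: (Rtrans (v := (g x S (f 0) +
    column (x |: S) (y :: s1 ++ s2) (fun k => f k.+1))%R)).
  by apply/RDl/IH => // k lek; [apply: eqf | apply: vf].
rewrite /= !addrA (setUCA [set y]) -(eqf 0) // addrC [X in R _ X]addrC; apply: RDl.
by apply: swap => //; [rewrite eq_sym | apply: vf].
Qed.

Lemma column_change S s t f : extends S s -> perm_eq s t ->
  (forall k, k < size s -> valid (f k)) ->
  (forall k, ~~ perm_eq (take k.+1 s) (take k.+1 t) -> f k = f k.+1) ->
  R (column S s f) (column S t f).
Proof.
elim: t S s f => [|y t IH] S s f ext pst vf eqf.
  by rewrite (perm_nilP pst); apply: Rxx.
have ys : y \in s by rewrite (perm_mem pst) mem_head.
case/splitPr: ys => s1 s2 in ext pst vf eqf *.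
have us : uniq (s1 ++ y :: s2) by case/and3P: ext.
have ys1 : y \notin s1.
  by move: us; rewrite cat_uniq => /and3P[_ + _]; rewrite /= negb_or => /andP[].
have perm12 : perm_eq (s1 ++ y :: s2) (y :: s1 ++ s2).
  by rewrite -(cat1s y s2) perm_catCA.
(* A prefix of [s1] still lacks [y], the head of [t]. *)
have eqf1 k : k < size s1 -> f k = f k.+1.
  move=> ltk; apply: eqf; apply: contra ys1 => /perm_mem/(_ y).
  rewrite /= mem_head takel_cat // => /mem_take; exact.
have szs : size (s1 ++ y :: s2) = (size (s1 ++ s2)).+1 by rewrite (perm_size perm12).
apply: (Rtrans (column_bubble ext eqf1 _)).
  by move=> k lek; apply: vf; rewrite szs size_cat ltnS (leq_trans lek) ?leq_addr.
have ext2 := extends_perm perm12 ext.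
have [_ _ _ _ ext'] := extends_cons ext2.
apply/RDl/IH => //.
- by rewrite -(perm_cons y) -(permPl perm12).
- by move=> k ltk; apply: vf; rewrite szs.
move=> k npk; have [ltk | lek] := ltnP k.+1 (size s1); first exact: eqf1.
(* Past [s1], moving [y] to the front leaves each prefix unchanged as a set, so a prefix that
   differs from that of [t] already did so before the move. *)
apply: eqf; apply: contra npk => /=.
have lek2 : (k.+2 < size s1) = false by lia.
have lek1 : (k.+1 < size s1) = false by lia.
rewrite !take_cat lek1 lek2 subSn //= => perm_y; rewrite -(perm_cons y).
by apply: perm_trans perm_y; rewrite perm_sym -(cat1s y (take _ s2)) perm_catCA.
Qed.

End Column.

(** * Grids made of two families of maximal chains, and their reduction to a canonical grid *)

Section Grid.

Variables (N : finType) (V : nmodType) (R : V -> V -> Prop).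
Hypothesis Rxx : forall u, R u u.
Hypothesis Rtrans : forall u v w, R u v -> R v w -> R u w.
Hypothesis RDl : forall w u v, R u v -> R (w + u)%R (w + v)%R.
Variable x0 : N.

(** The [i]-th step of the maximal chain given by [s]: the element added and the set it is added to.
    Past the end of [s] the element is the default [x0]. *)
Definition edge (s : seq N) i : N * {set N} :=
  (nth x0 s i, [set z in take i s]).

Definition cube_edge (A : {set N}) (e : N * {set N}) :=
  [&& e.1 \in A, e.1 \notin e.2 & e.2 \subset A].

Definition grid_sum (A B : {set N}) (cell : N * {set N} -> N * {set N} -> V)
    (col row : nat -> seq N) : V :=
  (\sum_(j < #|B|) \sum_(i < #|A|) cell (edge (col j) i) (edge (row i) j))%R.

Definition exchangeable (A B : {set N}) (cell : N * {set N} -> N * {set N} -> V) :=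
  forall (S : {set N}) x y e, x \in A -> y \in A -> x != y -> S \subset A ->
    x \notin S -> y \notin S -> cube_edge B e ->
    R (cell (x, S) e + cell (y, x |: S) e)%R (cell (y, S) e + cell (x, y |: S) e)%R.

Lemma R_sum n (F G : 'I_n -> V) : (forall i, R (F i) (G i)) ->
  R (\sum_(i < n) F i)%R (\sum_(i < n) G i)%R.
Proof.
move=> RFG; apply: big_ind2 => // u u' v v' Ru Rv.
by apply: Rtrans (RDl _ Rv) _; rewrite addrC [X in R _ X]addrC; apply: RDl.
Qed.

Lemma cube_edge_edge (A : {set N}) s i :
  perm_eq s (enum A) -> i < #|A| -> cube_edge A (edge s i).
Proof.
move=> ps ltiA; have us : uniq s by rewrite (perm_uniq ps) enum_uniq.
have szs : size s = #|A| by rewrite (perm_size ps) -cardE.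
have sA : s =i A by move=> z; rewrite (perm_mem ps) mem_enum.
apply/and3P; split=> /=; first by rewrite -sA mem_nth ?szs.
  rewrite inE; apply/negP => /(nthP x0)[j]; rewrite size_take szs ltiA => ltji.
  rewrite nth_take // => /eqP; rewrite nth_uniq ?szs ?(ltn_trans ltji) //.
  by move/eqP=> eqji; rewrite eqji ltnn in ltji.
by apply/subsetP=> z; rewrite inE => /mem_take; rewrite sA.
Qed.

(** The rows stay fixed, so [column_change] applies to each column separately, with row [k]
    supplying the edge paired with level [k]. *)
Lemma change_columns A B cell col col' row :
  exchangeable A B cell ->
  (forall j, perm_eq (col j) (enum A)) -> (forall j, perm_eq (col' j) (enum A)) ->
  (forall i, perm_eq (row i) (enum B)) ->
  (forall j k, ~~ perm_eq (take k.+1 (col j)) (take k.+1 (col' j)) ->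
     edge (row k) j = edge (row k.+1) j) ->
  R (grid_sum A B cell col row) (grid_sum A B cell col' row).
Proof.
move=> exch pc pc' pr edge_row; apply: R_sum => j.
have szA t : perm_eq t (enum A) -> #|A| = size t by move/perm_size; rewrite -cardE.
have columnE t : perm_eq t (enum A) ->
    (\sum_(i < #|A|) cell (edge t i) (edge (row i) j))%R =
    column (fun x S => cell (x, S)) set0 t (fun i => edge (row i) j).
  move=> pt; rewrite (column_sum _ x0) -(szA t) //.
  by apply: eq_bigr => i _; rewrite set0U.
rewrite !columnE //.
apply: (column_change Rxx Rtrans RDl (A := A) (valid := cube_edge B)) => //.
- rewrite /extends (perm_uniq (pc j)) enum_uniq sub0set; apply/allP=> z.
  by rewrite (perm_mem (pc j)) mem_enum /= inE => ->.
- by apply: perm_trans (pc j) _; rewrite perm_sym.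
- by move=> k _; apply: cube_edge_edge.
- by move=> k; apply: edge_row.
Qed.

Lemma change_rows A B cell col row row' :
  exchangeable B A (fun f e => cell e f) ->
  (forall j, perm_eq (col j) (enum A)) ->
  (forall i, perm_eq (row i) (enum B)) -> (forall i, perm_eq (row' i) (enum B)) ->
  (forall i k, ~~ perm_eq (take k.+1 (row i)) (take k.+1 (row' i)) ->
     edge (col k) i = edge (col k.+1) i) ->
  R (grid_sum A B cell col row) (grid_sum A B cell col row').
Proof.
move=> exch pc pr pr' edge_col; rewrite /grid_sum exchange_big [X in R _ X]exchange_big.
exact: (change_columns (cell := fun f e => cell e f)).
Qed.

Variables (A B : {set N}) (cell : N * {set N} -> N * {set N} -> V).
Hypothesis exchA : exchangeable A B cell.
Hypothesis exchB : exchangeable B A (fun f e => cell e f).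

(* The families are infinite, padded beyond the grid; there the prefixes are
   full orderings, so the condition holds for all [i] and [j]. *)
Definition compatible (col row : nat -> seq N) := forall i j,
  perm_eq (take i.+1 (col j)) (take i.+1 (col j.+1)) ||
  perm_eq (take j.+1 (row i)) (take j.+1 (row i.+1)).

(** Above level [k] the chain follows the order of [enum B], so rows that pass through the same set
    at level [k] share every later edge. *)
Definition recomplete k (s : seq N) :=
  take k s ++ [seq x <- enum B | x \notin take k s].

Lemma recomplete_perm k s : perm_eq s (enum B) -> perm_eq (recomplete k s) (enum B).
Proof.
move=> ps; have us : uniq s by rewrite (perm_uniq ps) enum_uniq.
rewrite /recomplete; apply: uniq_perm; rewrite ?enum_uniq //.
  rewrite cat_uniq take_uniq // filter_uniq ?enum_uniq // andbT.
  by apply/hasPn => x; rewrite mem_filter => /andP[].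
move=> x; rewrite mem_cat mem_filter -(perm_mem ps) andbC.
by case: (boolP (x \in take k s)) => [/mem_take-> | _] //=; rewrite andbT.
Qed.

Lemma take_recomplete i k s : perm_eq s (enum B) -> i <= k ->
  take i (recomplete k s) = take i s.
Proof.
move=> ps leik; have [les | lts] := leqP (size s) k.
  rewrite /recomplete (take_oversize les) (eq_in_filter (a2 := pred0)).
    by rewrite filter_pred0 cats0.
  by move=> x; rewrite (perm_mem ps) => ->.
by rewrite /recomplete takel_cat ?size_take ?lts // take_takel.
Qed.

Lemma edge_recomplete k l s t : perm_eq (take k s) (take k t) -> k <= l ->
  edge (recomplete k s) l = edge (recomplete k t) l.
Proof.
move=> pst lekl; rewrite /edge /recomplete.
have -> : [seq x <- enum B | x \notin take k t] = [seq x <- enum B | x \notin take k s].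
  by apply: eq_filter => x; rewrite (perm_mem pst).
have szl : (l < size (take k s)) = false.
  by apply/negbTE; rewrite -leqNgt (leq_trans _ lekl) // size_take_min geq_minl.
rewrite !nth_cat !take_cat -(perm_size pst) szl; congr pair.
by apply/setP=> z; rewrite !inE !mem_cat (perm_mem pst).
Qed.

Lemma equalize_columns k col row :
  (forall j, perm_eq (col j) (enum A)) -> (forall i, perm_eq (row i) (enum B)) ->
  compatible col row -> (forall j, k <= j -> col j = col k) ->
  exists s row', [/\ perm_eq s (enum A), forall i, perm_eq (row' i) (enum B)
    & R (grid_sum A B cell col row) (grid_sum A B cell (fun=> s) row')].
Proof.
elim: k col row => [|k IH] col row pc pr comp eqc.
  exists (col 0), row; split=> //.
  rewrite [X in R _ X](_ : _ = grid_sum A B cell col row) //.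
  by apply: eq_bigr => j _; rewrite eqc.
pose row1 i := recomplete k.+1 (row i).
pose col1 j := if k < j then col k else col j.
have pr1 i : perm_eq (row1 i) (enum B) by apply: recomplete_perm.
have pc1 j : perm_eq (col1 j) (enum A) by rewrite /col1; case: ifP.
have [||s [row' [ps pr' Rc]]] := IH col1 row1 pc1 pr1.
(* After [k] both columns are [col k]; before [k] the row prefixes are too short to have changed; at
   [k] the two new columns coincide by construction. *)
- move=> i j; rewrite /col1 /row1; case: (ltngtP k j) => [ltkj | gtkj|<-].
  + by rewrite ltnS ltnW // perm_refl.
  + by rewrite ltnS leqNgt gtkj /= !take_recomplete ?ltnS ?(ltnW gtkj) //; apply: comp.
  + by rewrite ltnSn perm_refl.
- by move=> j; rewrite /col1 ltnn leq_eqVlt => /predU1P[<-|->] //; rewrite ltnn.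
exists s, row'; split=> //; apply: Rtrans Rc.
apply: (Rtrans (v := grid_sum A B cell col row1)).
  apply: change_rows => // i l npl.
  (* A row changes only at levels above [k], where all columns are equal. *)
  have [lelk | ltkl] := leqP l.+1 k.+1.
    by move: npl; rewrite /row1 take_recomplete // perm_refl.
  by rewrite (eqc l) // (eqc l.+1) // ltnW.
apply: change_columns => // j l; rewrite /col1.
have [ltkj | _] := ltnP k j; last by rewrite perm_refl.
(* Column [j] is the old [col k.+1]. Where it differs from [col k] at level [l], compatibility makes
   rows [l] and [l + 1] agree as sets at level [k + 1], hence, once recompleted, on the edge at
   [j]. *)
move=> npl; apply: edge_recomplete => //.
by case/orP: (comp l k) => //; rewrite -(eqc j) // perm_sym (negPf npl).
Qed.

(** Once all columns are equal, the rows can be changed without restriction; once all rows are equal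
    too, so can the columns. *)
Lemma canonical_grid col row :
  (forall j, perm_eq (col j) (enum A)) -> (forall i, perm_eq (row i) (enum B)) ->
  compatible col row -> (exists k, forall j, k <= j -> col j = col k) ->
  R (grid_sum A B cell col row)
    (grid_sum A B cell (fun=> enum A) (fun=> enum B)).
Proof.
move=> pc pr comp [k eqc].
have [s [row' [ps pr' Rc]]] := equalize_columns pc pr comp eqc.
apply: Rtrans Rc _; apply: (Rtrans (v := grid_sum A B cell (fun=> s) (fun=> enum B))).
  exact: change_rows.
exact: change_columns.
Qed.

End Grid.

(** * Integral unit flows in the cube of subsets of [B] *)

Section UnitFlow.

Variables (N : finType) (x0 : N) (B : {set N}) (I : finType).
Variables (b : I -> N) (T : I -> {set N}) (th : I -> nat).
Hypothesis bT : forall i, cube_edge B (b i, T i).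
(** Kirchhoff's law with source [set0] and sink [B], arranged so that no natural numbers are
    subtracted. *)
Hypothesis conservation : forall U : {set N},
  \sum_(i | T i == U) th i + (U == B) =
  \sum_(i | b i |: T i == U) th i + (U == set0).

Lemma sum_single (P : pred I) i0 : th i0 = 1 ->
  (forall i, P i -> 0 < th i -> i = i0) -> \sum_(i | P i) th i = P i0.
Proof.
move=> th0 uni; rewrite big_mkcond (bigD1 i0) //= th0 big1 ?addn0; first by case: (P i0).
move=> i ni; case: ifP => // Pi; apply/eqP; rewrite -leqn0 leqNgt.
by apply: contra ni => /(uni i Pi)->.
Qed.

(** Induction on the level. The unit entering level [k] at the current set must leave it; a sum of
    natural numbers equal to one is carried by a single index, whose element extends the chain. *)
Lemma unit_flow_prefix k : k <= #|B| -> exists s,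
  [/\ size s = k, uniq s, {subset s <= B},
      forall i, 0 < th i -> #|T i| < k -> (b i, T i) = edge x0 s #|T i| &
      (forall j, j < k -> \sum_(i | (b i, T i) == edge x0 s j) th i = 1) /\
      forall U : {set N}, #|U| = k ->
        \sum_(i | b i |: T i == U) th i + (U == set0) = (U == [set z in s])].
Proof.
elim: k => [|k IH] lekB.
  exists [::]; split=> //; split=> // U /eqP; rewrite cards_eq0 => /eqP->.
  rewrite set_nil eqxx big1 // => i /eqP/setP/(_ (b i)).
  by rewrite !inE eqxx.
have [s [szs us sB es [es1 inflow]]] := IH (ltnW lekB).
(* Below level [#|B|] the sink term vanishes, so outflow equals inflow plus the source term. *)
have outflow (U : {set N}) : #|U| = k -> \sum_(i | T i == U) th i = (U == [set z in s]).
  move=> cU; rewrite -inflow // -conservation; case: eqP => [eqU|_].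
    by rewrite -cU eqU ltnn in lekB.
  by rewrite addn0.
have cs : #|[set z in s]| = k by rewrite cardsE (card_uniqP us).
have := outflow _ cs; rewrite eqxx => /eqP/sum_nat_eq1[i0 [/eqP Ti0 th0 only_i0]].
have uni i : 0 < th i -> #|T i| = k -> i = i0.
  move=> thi cTi; have [eqT | neqT] := eqVneq (T i) [set z in s].
    apply/eqP; apply: contraTT thi => ni; rewrite -leqNgt leqn0; apply/eqP.
    by apply: only_i0; rewrite ?eqT.
  have := outflow _ cTi; rewrite (negPf neqT) => /eqP.
  by rewrite sum_nat_eq0 => /forallP/(_ i); rewrite eqxx /= eqn0Ngt thi.
have /and3P[/= bB bs _] := bT i0; rewrite Ti0 inE in bs.
have edgeE j : j < k -> edge x0 (rcons s (b i0)) j = edge x0 s j.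
  by move=> ltj; rewrite /edge nth_rcons szs ltj -cats1 takel_cat // szs ltnW.
have edgek : edge x0 (rcons s (b i0)) k = (b i0, T i0).
  rewrite /edge nth_rcons szs ltnn eqxx -cats1 takel_cat ?szs //.
  by rewrite take_oversize ?szs ?Ti0.
exists (rcons s (b i0)); split.
- by rewrite size_rcons szs.
- by rewrite rcons_uniq bs.
- by move=> z; rewrite mem_rcons inE => /predU1P[->|/sB].
- move=> i thi; rewrite ltnS leq_eqVlt => /predU1P[cTi | ltTi]; last by rewrite edgeE // es.
  by rewrite cTi edgek (uni i).
split=> [j | U cU].
  rewrite ltnS leq_eqVlt => /predU1P[-> | ltj]; last by rewrite edgeE // es1.
  rewrite edgek (@sum_single _ i0) ?eqxx // => i /eqP[_ eqT] thi.
  by apply: uni; rewrite // eqT Ti0.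
have -> : (U == set0) = false by rewrite -cards_eq0 cU.
rewrite addn0 (@sum_single _ i0) //; last first.
  move=> i /eqP eqU thi; apply: uni => //; have /and3P[_ /= bTi _] := bT i.
  by move: cU; rewrite -eqU cardsU1 bTi => -[].
rewrite Ti0 eq_sym; congr (_ == _ : nat).
by apply/setP=> z; rewrite !inE mem_rcons inE.
Qed.

Lemma unit_flow_path : exists s, [/\ perm_eq s (enum B),
  forall i, 0 < th i -> (b i, T i) = edge x0 s #|T i| &
  forall j, j < #|B| -> \sum_(i | (b i, T i) == edge x0 s j) th i = 1].
Proof.
have [s [szs us sB es [es1 _]]] := unit_flow_prefix (leqnn _).
exists s; split=> //.
  apply: uniq_perm; rewrite ?enum_uniq // => z; rewrite mem_enum.
  have sB' : [set z in s] \subset B by apply/subsetP => y; rewrite inE => /sB.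
  have /eqP <- : [set z in s] == B by rewrite eqEcard sB' cardsE (card_uniqP us) szs /=.
  by rewrite inE.
move=> i thi; apply: es => //; apply: proper_card; have /and3P[bB bTi TB] := bT i.
by rewrite properE TB; apply/subsetPn; exists (b i).
Qed.

End UnitFlow.

Lemma semielemE (N : finType) (A B C P : {set N}) : semielem A B C P =
  ((P == A :|: B :|: C)%:R + (P == C)%:R - (P == A :|: C)%:R - (P == B :|: C)%:R)%R.
Proof. by rewrite !ffunE. Qed.

Lemma semielemC (N : finType) (A B C : {set N}) : semielem A B C = semielem B A C.
Proof. by apply/ffunP=> P; rewrite !semielemE (setUC A B) addrAC. Qed.

(** * Extracting rows from a representation by means of level sums *)

Section Levels.

Variables (N : finType) (x0 : N) (A B C : {set N}).
Hypotheses (dAB : [disjoint A & B]) (dAC : [disjoint A & C]) (dBC : [disjoint B & C]).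
Variables (I : finType) (a b : I -> N) (G : I -> {set N}) (th : I -> nat).

Definition index_triple (a b : N) (G : {set N}) :=
  [&& a \in A, b \in B, C \subset G & G \subset (A :|: B :|: C) :\: [set a; b]].

Hypothesis abG : forall i, index_triple (a i) (b i) (G i).
Hypothesis repr :
  semielem A B C = (\sum_i elem (a i) (b i) (G i) *+ th i)%R.

Lemma index_tripleP x y (H : {set N}) : index_triple x y H ->
  [/\ x \in A, y \in B, x \notin H, y \notin H &
   [/\ y \notin A, x \notin B, x \notin C, y \notin C &
    H = (H :&: A) :|: (H :&: B) :|: C]].
Proof.
case/and4P=> xA yB CH /subsetP sH.
have nH z : z \in [set x; y] -> z \notin H.
  by move=> zxy; apply/negP=> /sH; rewrite inE zxy.
split=> //; try by apply: nH; rewrite !inE eqxx ?orbT.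
split; rewrite ?(disjointFr dAB xA) ?(disjointFl dAB yB) //.
- by rewrite (disjointFr dAC xA).
- by rewrite (disjointFr dBC yB).
apply/setP=> z; rewrite !inE -andb_orr; have [/sH | nzH] := boolP (z \in H).
  by rewrite !inE => /andP[_ /=] => ->.
by apply/esym/negbTE; apply: contra nzH; apply: (subsetP CH).
Qed.

Lemma index_triple_card x y (H : {set N}) : index_triple x y H ->
  #|H :&: A| < #|A| /\ #|H :&: B| < #|B|.
Proof.
move=> /index_tripleP[xA yB xH yH _].
split; apply: proper_card; rewrite properE subsetIr; apply/subsetPn.
  by exists x; rewrite // inE (negPf xH).
by exists y; rewrite // inE (negPf yH).
Qed.

(* [level_sum k U] kills every elementary imset but those whose step in
   [A] goes from size [k] to size [k + 1]. *)
Definition level_sum (k : nat) (U : {set N}) (f : imsetType N) : int :=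
  (\sum_(P : {set N} | (P :&: B == U) && (k < #|P :&: A|)%N) f P)%R.

Lemma level_sum_delta k U Q :
  level_sum k U (delta Q) = ((Q :&: B == U) && (k < #|Q :&: A|)%N)%:R%R.
Proof.
rewrite /level_sum big_mkcond (bigD1 Q) //= ffunE eqxx big1 ?addr0; first by case: ifP.
by move=> P nP; rewrite ffunE (negPf nP) if_same.
Qed.

Lemma level_sumD k U f g :
  level_sum k U (f + g)%R = (level_sum k U f + level_sum k U g)%R.
Proof. by rewrite /level_sum -big_split; apply: eq_bigr => P _; rewrite ffunE. Qed.

Lemma level_sumN k U f : level_sum k U (- f)%R = (- level_sum k U f)%R.
Proof. by rewrite /level_sum -sumrN; apply: eq_bigr => P _; rewrite ffunE. Qed.

(** This is the boundary of a unit flow from [set0] to [B]: the terms at [C] and [B :|: C] vanish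
    because these sets do not meet [A]. *)
Lemma level_sum_semielem k U : k < #|A| ->
  level_sum k U (semielem A B C) = ((B == U)%:R - (set0 == U)%:R)%R.
Proof.
move=> ltkA; rewrite /semielem !(level_sumD, level_sumN) !level_sum_delta.
have AB0 := disjoint_setI0 dAB; have BA0 : B :&: A = set0 by rewrite setIC.
have CA0 : C :&: A = set0 by rewrite setIC disjoint_setI0.
have CB0 : C :&: B = set0 by rewrite setIC disjoint_setI0.
rewrite !setIUl AB0 BA0 CA0 CB0 !setIid !setU0 !set0U ltkA cards0 ltn0.
by rewrite !andbT !andbF addr0 subr0.
Qed.

(** Put [h = #|H :&: A|]. Two terms with the same trace on [B] have opposite signs and sizes [h] and
    [h + 1] on [A]; together they leave the indicator of [k = h]. What remains is the boundary of
    one edge in the cube of [B]. *)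
Lemma level_sum_elem k U x y H : index_triple x y H ->
  level_sum k U (elem x y H) =
  (if #|H :&: A| == k then (y |: (H :&: B) == U)%:R - (H :&: B == U)%:R else 0)%R.
Proof.
move=> /index_tripleP[xA yB xH yH [yA xB _ _ _]].
rewrite /elem /semielem !(level_sumD, level_sumN) !level_sum_delta.
have x1A : [set x] :&: A = [set x] by apply/setIidPl; rewrite sub1set.
have y1B : [set y] :&: B = [set y] by apply/setIidPl; rewrite sub1set.
have x1B : [set x] :&: B = set0 by apply/disjoint_setI0; rewrite disjoints1.
have y1A : [set y] :&: A = set0 by apply/disjoint_setI0; rewrite disjoints1.
rewrite !setIUl x1A y1B x1B y1A !set0U !setU0 !cardsU1 !inE (negPf xH) add1n.
rewrite ltnS; case: (ltngtP k #|H :&: A|) => _; rewrite ?andbT ?andbF.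
- by rewrite addrK subrr.
- by rewrite !subrr.
- by rewrite mulr0n addr0 subr0.
Qed.

Lemma level_sum0 k U : level_sum k U 0%R = 0%R.
Proof. by rewrite /level_sum big1 // => P _; rewrite ffunE. Qed.

Lemma level_sumMn k U f n : level_sum k U (f *+ n)%R = (level_sum k U f *+ n)%R.
Proof.
by elim: n => [|n IH]; rewrite ?mulr0n ?level_sum0 // !mulrS level_sumD IH.
Qed.

(** Applying [level_sum k] to [repr] yields the conservation law for the part of [th] at level [k]
    in [A], viewed as a flow in the cube of [B]. *)
Lemma row_path k : k < #|A| -> exists s, [/\ perm_eq s (enum B),
  forall i, 0 < th i -> #|G i :&: A| = k ->
    (b i, G i :&: B) = edge x0 s #|G i :&: B| &
  forall j, j < #|B| ->
    \sum_(i | (#|G i :&: A| == k) && ((b i, G i :&: B) == edge x0 s j)) th i = 1].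
Proof.
move=> ltkA; pose thk i := if #|G i :&: A| == k then th i else 0.
have sum_thk (Q : pred I) :
    \sum_(i | Q i) thk i = \sum_(i | (#|G i :&: A| == k) && Q i) th i.
  by rewrite -big_mkcondl.
have edgeB i : cube_edge B (b i, G i :&: B).
  have [_ yB _ yG _] := index_tripleP (abG i).
  by rewrite /cube_edge /= yB inE (negPf yG) subsetIr.
have [|s [ps es es1]] := unit_flow_path x0 (th := thk) edgeB.
  move=> U; have := congr1 (level_sum k U) repr.
  rewrite level_sum_semielem // (big_morph _ (level_sumD k U) (level_sum0 k U)).
  have -> : (\sum_i level_sum k U (elem (a i) (b i) (G i) *+ th i) =
     (\sum_(i | b i |: (G i :&: B) == U) thk i)%:R
     - (\sum_(i | G i :&: B == U) thk i)%:R)%R.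
    rewrite [X in (X%:R - _)%R]big_mkcond [X in (_ - X%:R)%R]big_mkcond /=.
    rewrite !natr_sum -sumrB; apply: eq_bigr => i _.
    rewrite level_sumMn (level_sum_elem _ _ (abG i)) /thk.
    by case: (_ == k); case: (_ == U); case: (_ == U);
      rewrite ?mul0rn ?subr0 ?subrr ?mul0rn ?sub0r ?mulNrn.
  rewrite [U == B]eq_sym [U == set0]eq_sym; lia.
exists s; split=> // [i thi cGi | j ltjB]; last by rewrite -sum_thk es1.
by apply: es; rewrite /thk cGi eqxx.
Qed.

End Levels.

Lemma index_tripleC (N : finType) (A B C : {set N}) x y H :
  index_triple A B C x y H = index_triple B A C y x H.
Proof. by rewrite /index_triple andbCA (setUC A) (setUC [set x]). Qed.

(** Finite choice, padded by [d] from [m] on. The padding makes the family of columns eventually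
    constant, which is where the descent in [equalize_columns] starts. *)
Lemma choose_below (T : Type) (d : T) m (P : nat -> T -> Prop) :
  (forall k, k < m -> exists s, P k s) ->
  exists f, (forall k, k < m -> P k (f k)) /\ (forall k, m <= k -> f k = d).
Proof.
move=> exP; have [g Pg] : exists g : 'I_m -> T, forall i : 'I_m, P i (g i).
  by apply: (fin_all_exists (P := fun i : 'I_m => P i)) => i; apply: exP.
exists (fun k => oapp g d (insub k)); split=> k lek.
  by rewrite insubT /=; apply: (Pg (Ordinal lek)).
by rewrite insubF // ltnNge lek.
Qed.

Lemma take_set_card (N : finType) (A : {set N}) s k : perm_eq s (enum A) -> k <= #|A| ->
  #|[set z in take k s]| = k.
Proof.
move=> ps lek; rewrite cardsE (card_uniqP _) ?size_takel ?(perm_size ps) -?cardE //.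
by rewrite take_uniq // (perm_uniq ps) enum_uniq.
Qed.

Lemma take_set_sub (N : finType) (A : {set N}) s k : perm_eq s (enum A) ->
  [set z in take k s] \subset A.
Proof.
by move=> ps; apply/subsetP=> z; rewrite inE => /mem_take; rewrite (perm_mem ps) mem_enum.
Qed.

Lemma edge_set (N : finType) x0 (A : {set N}) s k : perm_eq s (enum A) -> k < #|A| ->
  (edge x0 s k).1 |: (edge x0 s k).2 = [set z in take k.+1 s].
Proof.
move=> ps ltk; apply/setP=> z.
by rewrite (take_nth x0) ?(perm_size ps) -?cardE // !inE mem_rcons inE.
Qed.

(** * A representation as a compatible grid *)

Section Decompose.

Variables (N : finType) (x0 : N) (A B C : {set N}).
Hypotheses (dAB : [disjoint A & B]) (dAC : [disjoint A & C]) (dBC : [disjoint B & C]).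
Variables (I : finType) (a b : I -> N) (G : I -> {set N}) (th : I -> nat).
Hypothesis abG : forall i, index_triple A B C (a i) (b i) (G i).
Hypothesis repr :
  semielem A B C = (\sum_i elem (a i) (b i) (G i) *+ th i)%R.

Definition on_grid (col row : nat -> seq N) := forall i, 0 < th i ->
  (a i, G i :&: A) = edge x0 (col #|G i :&: B|) #|G i :&: A| /\
  (b i, G i :&: B) = edge x0 (row #|G i :&: A|) #|G i :&: B|.

Definition covers_grid (col row : nat -> seq N) := forall k l, k < #|A| -> l < #|B| ->
  exists i, [/\ th i = 1, (a i, G i :&: A) = edge x0 (col l) k
    & (b i, G i :&: B) = edge x0 (row k) l].

(** Suppose both alternatives fail, and evaluate [repr] at [P], the union of [C] with the sets
    reached by column [l] at level [k + 1] and by row [k] at level [l + 1]. No cell contributes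
    negatively, and cell [(k, l)] has [P] as its top, so the right side is positive. But [P] is
    neither [A :|: B :|: C] nor [C], so the left side is at most zero. *)
Lemma grid_compatible_in col row k l :
  (forall j, perm_eq (col j) (enum A)) -> (forall i, perm_eq (row i) (enum B)) ->
  on_grid col row -> covers_grid col row -> k.+1 < #|A| -> l.+1 < #|B| ->
  ([set z in take k.+1 (col l)] == [set z in take k.+1 (col l.+1)]) ||
  ([set z in take l.+1 (row k)] == [set z in take l.+1 (row k.+1)]).
Proof.
move=> pc pr on cov ltk ltl; apply/negPn; rewrite negb_or; apply/negP=> /andP[ncol nrow].
set S := [set z in take k.+1 (col l)] in ncol.
set T := [set z in take l.+1 (row k)] in nrow.
have SA : S \subset A by apply: take_set_sub.
have TB : T \subset B by apply: take_set_sub.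
have cS : #|S| = k.+1 by apply: (take_set_card (pc l)); apply: ltnW.
have cT : #|T| = l.+1 by apply: (take_set_card (pr k)); apply: ltnW.
pose P := S :|: T :|: C.
have PA : P :&: A = S.
  rewrite /P !setIUl (setIidPl SA) [C :&: A]setIC (disjoint_setI0 dAC) setU0.
  by rewrite (disjoint_setI0 (disjointWl TB _)) ?setU0 // disjoint_sym.
have PB : P :&: B = T.
  rewrite /P !setIUl (setIidPl TB) [C :&: B]setIC (disjoint_setI0 dBC) setU0.
  by rewrite (disjoint_setI0 (disjointWl SA _)) ?set0U.
have neqA Q : (Q :&: A != S) -> (P == Q) = false.
  by move=> nQ; apply: contra_neqF nQ => /eqP<-.
have /ffunP/(_ P) := repr.
rewrite semielemE (neqA (A :|: B :|: C)) ?(neqA C); last 2 first.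
- by rewrite [C :&: A]setIC (disjoint_setI0 dAC) eq_sym -cards_eq0 cS.
- have /setIidPr -> : A \subset A :|: B :|: C by rewrite -setUA subsetUl.
  by apply: contraTneq ltk => eqAS; rewrite eqAS cS ltnn.
rewrite sum_ffunE.
have elemP i : 0 < th i -> elem (a i) (b i) (G i) P =
    ((P == [set a i] :|: [set b i] :|: G i)%:R + (P == G i)%:R)%R.
  move=> thi; have [eqa eqb] := on i thi; rewrite /elem semielemE.
  have [aA bB aG bG [bA aB _ _ _]] := index_tripleP dAB dAC dBC (abG i).
  have [ltA ltB] := index_triple_card dAB dAC dBC (abG i).
  (* Such a cell would lie in column [l + 1] at level [k], forcing that column to pass through [S],
     against [ncol]. *)
  have -> : (P == [set a i] :|: G i) = false.
    apply/eqP=> eqP_; move: PA PB; rewrite eqP_ !setIUl.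
    rewrite (setIidPl _) ?sub1set // (disjoint_setI0 (B := B)) ?disjoints1 // set0U => eqS eqT.
    have eqk : #|G i :&: A| = k.
      by move: cS; rewrite -eqS cardsU1 inE (negPf aG) => -[].
    move: eqa ncol; rewrite -eqS eqT cT eqk => eqa.
    by rewrite -(edge_set x0 (pc l.+1)) ?(ltnW ltk) // -eqa eqxx.
  have -> : (P == [set b i] :|: G i) = false.
    apply/eqP=> eqP_; move: PA PB; rewrite eqP_ !setIUl.
    rewrite [[set b i] :&: B](setIidPl _) ?sub1set //.
    rewrite (disjoint_setI0 (B := A)) ?disjoints1 // set0U => eqS eqT.
    have eql : #|G i :&: B| = l.
      by move: cT; rewrite -eqT cardsU1 inE (negPf bG) => -[].
    move: eqb nrow; rewrite -eqT eqS cS eql => eqb.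
    by rewrite -(edge_set x0 (pr k.+1)) ?(ltnW ltl) // -eqb eqxx.
  by rewrite !subr0.
have ge0 i : (0 <= (elem (a i) (b i) (G i) *+ th i)%R P)%R.
  rewrite ffunMnE; have [->|thi] := posnP (th i); first by rewrite mulr0n.
  by rewrite elemP // -natrD mulrn_wge0 // ler0n.
have [i [thi eqa eqb]] := cov k l (ltnW ltk) (ltnW ltl).
have gt0 : (0 < (elem (a i) (b i) (G i) *+ th i)%R P)%R.
  have [_ _ _ _ [_ _ _ _ GE]] := index_tripleP dAB dAC dBC (abG i).
  rewrite thi mulr1n elemP ?thi // (_ : P == _) ?ltr_wpDr ?ler0n ?ltr01 //.
  rewrite GE setUA setUACA /P /S /T -(edge_set x0 (pc l)) ?(ltnW ltk) //.
  by rewrite -(edge_set x0 (pr k)) ?(ltnW ltl) // -eqa -eqb.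
move=> eqP0.
have : (0 < \sum_i (elem (a i) (b i) (G i) *+ th i)%R P)%R.
  by rewrite (bigD1 i) //= ltr_wpDr // sumr_ge0.
rewrite -eqP0.
have := ler0n int (P == A :|: C); have := ler0n int (P == B :|: C).
lia.
Qed.

Lemma grid_exists : exists col row,
  [/\ forall j, perm_eq (col j) (enum A), forall i, perm_eq (row i) (enum B),
      on_grid col row /\ covers_grid col row,
      compatible col row & forall j, #|B| <= j -> col j = col #|B|].
Proof.
have ltAB i := index_triple_card dAB dAC dBC (abG i).
have [row [rowP row_out]] :=
  choose_below (enum B) (row_path x0 dAB dAC dBC abG repr).
(* The columns are the rows obtained with [A] and [B] interchanged. *)
have reprC : semielem B A C = (\sum_i elem (b i) (a i) (G i) *+ th i)%R.
  by rewrite semielemC repr; apply: eq_bigr => i _; rewrite /elem semielemC.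
have abGC i : index_triple B A C (b i) (a i) (G i) by rewrite index_tripleC.
have dBA : [disjoint B & A] by rewrite disjoint_sym.
have [col [colP col_out]] :=
  choose_below (enum A) (row_path x0 dBA dBC dAC abGC reprC).
have pr i : perm_eq (row i) (enum B).
  by have [/rowP[]|/row_out->] := ltnP i #|A|.
have pc j : perm_eq (col j) (enum A).
  by have [/colP[]|/col_out->] := ltnP j #|B|.
have on : on_grid col row.
  move=> i thi; have [/rowP[_ rowE _] /colP[_ colE _]] := ltAB i.
  by rewrite colE // rowE.
(* The weight one on an edge of row [k] is carried by a single index, which [on] then places in
   column [l]. *)
have cov : covers_grid col row.
  move=> k l ltk ltl; have [_ _ /(_ l ltl)/eqP/sum_nat_eq1[i []]] := rowP k ltk.
  move=> /andP[/eqP ck /eqP eqb] thi _.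
  have cl : #|G i :&: B| = l.
    by move/(congr1 snd): eqb => /= ->; apply: (take_set_card (pr k)); apply: ltnW.
  by exists i; have [] := on i _; rewrite ?thi // ck cl.
exists col, row; split=> // [k l | j lej]; last by rewrite !col_out.
have perm_take (D : {set N}) s t n : perm_eq s (enum D) -> perm_eq t (enum D) ->
    [set z in take n s] == [set z in take n t] -> perm_eq (take n s) (take n t).
  move=> ps pt /eqP/setP eq_st; apply: uniq_perm.
  - by rewrite take_uniq // (perm_uniq ps) enum_uniq.
  - by rewrite take_uniq // (perm_uniq pt) enum_uniq.
  by move=> z; have := eq_st z; rewrite !inE.
have perm_full (D : {set N}) s t n : perm_eq s (enum D) ->
    perm_eq t (enum D) -> #|D| <= n -> perm_eq (take n s) (take n t).
  move=> ps pt len; rewrite !take_oversize ?(perm_size ps) ?(perm_size pt) -?cardE //.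
  by apply: perm_trans ps _; rewrite perm_sym.
have [lek | ltk] := leqP #|A| k.+1; first by rewrite (perm_full A).
have [lel | ltl] := leqP #|B| l.+1; first by rewrite orbC (perm_full B).
case/orP: (grid_compatible_in pc pr on cov ltk ltl) => eq_set.
  by rewrite (perm_take A).
by rewrite orbC (perm_take B).
Qed.

End Decompose.

(** Both sides telescope to [semielem [set a] [set b1; b2] G]. *)
Lemma elem_exchange_r (N : finType) (a b1 b2 : N) (G : {set N}) :
  (elem a b1 G + elem a b2 (b1 |: G) = elem a b2 G + elem a b1 (b2 |: G))%R.
Proof.
rewrite /elem /semielem !setUA.
rewrite -!(setUA [set a]) (setUC [set b1] [set b2]).
have telescope (D E F H I J : imsetType N) :
  ((D + E - F - H) + (I + H - D - J) = (I + E - F - J))%R.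
  by apply/ffunP=> P; rewrite !ffunE; move: (D P) (E P) (F P) (H P) (I P) (J P) => *; lia.
by rewrite !telescope.
Qed.

(** * Cells as coefficient vectors, and moves between them *)

Section Moves.

Variables (N : finType) (A B C : {set N}).
Hypotheses (dAB : [disjoint A & B]) (dAC : [disjoint A & C]) (dBC : [disjoint B & C]).

Definition dirac (w : imsetType N) : coefs A B C :=
  [ffun u => (fsval u == w : nat)].

Definition grid_cell (e f : N * {set N}) : coefs A B C :=
  dirac (elem e.1 f.1 (e.2 :|: f.2 :|: C)).

(** The vectors on the way are not asked to lie in the fiber, so that links between partial sums of
    cells can be added up; [adjacent_fiber] recovers membership afterwards. *)
Definition linked : coefs A B C -> coefs A B C -> Prop :=
  clos_refl_trans_1n _ (@adjacent N A B C).

Lemma adjacentDl (w u v : coefs A B C) : adjacent u v -> adjacent (w + u)%R (w + v)%R.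
Proof.
rewrite /adjacent; congr (two_by_two_move _); apply/ffunP=> z.
by rewrite !ffunE !natrDE !PoszD opprD addrACA subrr add0r.
Qed.

Lemma adjacent_sym (u v : coefs A B C) : adjacent u v -> adjacent v u.
Proof.
have opp : [ffun z => (v z)%:Z - (u z)%:Z]%R = (- [ffun z => (u z)%:Z - (v z)%:Z])%R
    :> {ffun elems A B C -> int}.
  by apply/ffunP=> z; rewrite !ffunE opprB.
by rewrite /adjacent opp => -[]; [right; rewrite opprK | left].
Qed.

Lemma linked_trans u v w : linked u v -> linked v w -> linked u w.
Proof.
move=> luv; elim: luv w => // x y z xy _ IH w lzw; exact: rt1n_trans xy (IH w lzw).
Qed.

Lemma linked_sym u v : linked u v -> linked v u.
Proof.
elim=> [x | x y z xy _ yx]; first exact: rt1n_refl.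
apply: linked_trans yx (rt1n_trans _ _ _ _ _ (adjacent_sym xy) _); exact: rt1n_refl.
Qed.

Lemma linkedDl w u v : linked u v -> linked (w + u)%R (w + v)%R.
Proof.
elim=> [x | x y z xy _ IH]; first exact: rt1n_refl.
exact: rt1n_trans (adjacentDl _ xy) IH.
Qed.

Lemma linked_step (u v : coefs A B C) :
  basic_diff [ffun z => (u z)%:Z - (v z)%:Z]%R -> linked u v.
Proof. by move=> d; apply: rt1n_trans _ (rt1n_refl _ _ _); left. Qed.

Lemma dirac_diff w1 w2 w3 w4 :
  [ffun z => ((dirac w1 + dirac w2)%R z)%:Z - ((dirac w3 + dirac w4)%R z)%:Z]%R =
  (unitvec A B C w1 + unitvec A B C w2 - (unitvec A B C w3 + unitvec A B C w4))%R.
Proof. by apply/ffunP=> z; rewrite !ffunE !natrDE; lia. Qed.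

Lemma subsetD_set3 (G D : {set N}) x y z :
  (G \subset D :\: [set x; y; z]) = [&& G \subset D, x \notin G, y \notin G & z \notin G].
Proof.
by rewrite subsetD disjoint_sym disjoints_subset !subUset !sub1set !inE -!andbA.
Qed.

Lemma subsetD_set2 (G D : {set N}) x y :
  (G \subset D :\: [set x; y]) = [&& G \subset D, x \notin G & y \notin G].
Proof. by rewrite subsetD disjoint_sym disjoints_subset !subUset !sub1set !inE. Qed.

Lemma notin_cell (S T : {set N}) z : S \subset A -> T \subset B ->
  (z \in A) && (z \notin S) || (z \in B) && (z \notin T) -> z \notin S :|: T :|: C.
Proof.
move=> /subsetP SA /subsetP TB; rewrite !inE !negb_or => /orP[] /andP[zAB zST].
  rewrite zST (disjointFr dAC zAB) andbT; apply/negP=> /TB.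
  by rewrite (disjointFr dAB zAB).
rewrite zST (disjointFr dBC zAB) !andbT; apply/negP=> /SA.
by rewrite (disjointFl dAB zAB).
Qed.

Lemma cell_sub (S T : {set N}) : S \subset A -> T \subset B ->
  S :|: T :|: C \subset A :|: B :|: C.
Proof. by move=> SA TB; apply/setSU/setUSS. Qed.

(** Exchanging [x] and [y] against a fixed edge [(b, T)] is the relation [BasicDiffA] with
    [G = S :|: T :|: C]. *)
Lemma grid_cell_exchA : exchangeable linked A B grid_cell.
Proof.
move=> S x y [b T] xA yA nxy SA xS yS /and3P[/= bB bT TB]; apply: linked_step.
rewrite dirac_diff /= -[x |: S :|: T]setUA -[y |: S :|: T]setUA -!(setUA [set _]).
apply: BasicDiffA => //; first exact: subsetUr.
rewrite subsetD_set3 cell_sub //=.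
by rewrite !notin_cell // ?xA ?yA ?bB ?xS ?yS ?bT ?orbT.
Qed.

Lemma grid_cell_exchB : exchangeable linked B A (fun f e => grid_cell e f).
Proof.
move=> T x y [a S] xB yB nxy TB xT yT /and3P[/= aA aS SA]; apply: linked_step.
rewrite dirac_diff /= !(setUCA S) -!(setUA [set _]).
apply: BasicDiffB => //; first exact: subsetUr.
rewrite subsetD_set3 cell_sub //=.
by rewrite !notin_cell // ?xB ?yB ?aA ?xT ?yT ?aS ?orbT.
Qed.

(** * The fiber: invariance under moves, and its members as grids *)

Lemma mem_elems a b G : index_triple A B C a b G -> elem a b G \in elems A B C.
Proof. by move=> abG; apply/imfsetP; exists (a, b, G). Qed.

(* Choosing one triple per imset avoids proving that [elem] is injective. *)
Lemma elems_index : exists t : elems A B C -> N * N * {set N}, forall u,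
  index_triple A B C (t u).1.1 (t u).1.2 (t u).2 /\
  fsval u = elem (t u).1.1 (t u).1.2 (t u).2.
Proof.
apply: (fin_all_exists (P := fun u (t : N * N * {set N}) =>
  index_triple A B C t.1.1 t.1.2 t.2 /\ fsval u = elem t.1.1 t.1.2 t.2)) => u.
by have /imfsetP[t /= Kt ut] := fsvalP u; exists t.
Qed.

Lemma unitvec_value w : w \in elems A B C ->
  (\sum_(u : elems A B C) fsval u *~ unitvec A B C w u)%R = w.
Proof.
move=> wE; rewrite (bigD1 [` wE]%fset) //= ffunE eqxx big1 ?addr0 // => u nu.
rewrite ffunE (_ : (_ == _) = false) //; apply: contraNF nu => /eqP uw.
by apply/eqP/val_inj.
Qed.

(** A [unitvec] outside [elems] would be zero and lose its term, so all four imsets are first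
    located in [elems]; then [elem_exchange_r] gives the cancellation. *)
Lemma basic_diff_value d : basic_diff d ->
  (\sum_(u : elems A B C) fsval u *~ d u)%R = 0%R.
Proof.
have sum4 w1 w2 w3 w4 : w1 \in elems A B C -> w2 \in elems A B C ->
    w3 \in elems A B C -> w4 \in elems A B C -> (w1 + w2 = w3 + w4)%R ->
    (\sum_(u : elems A B C) fsval u *~ (unitvec A B C w1 + unitvec A B C w2
      - (unitvec A B C w3 + unitvec A B C w4))%R u)%R = 0%R.
  move=> E1 E2 E3 E4 eqw.
  rewrite (eq_bigr (fun u : elems A B C =>
    (fsval u *~ unitvec A B C w1 u + fsval u *~ unitvec A B C w2 u
    - (fsval u *~ unitvec A B C w3 u + fsval u *~ unitvec A B C w4 u))%R)); last first.
    by move=> u _; rewrite !ffunE mulrzBr !mulrzDr.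
  by rewrite sumrB !big_split /= !unitvec_value // eqw subrr.
have sub_in x (G : {set N}) : x \in A :|: B -> G \subset A :|: B :|: C ->
    x |: G \subset A :|: B :|: C.
  by move=> xAB GABC; rewrite subUset sub1set inE xAB.
have neqAB x y : x \in A -> y \in B -> (x == y = false) * (y == x = false).
  by move=> xA yB; rewrite [y == x]eq_sym; split;
    apply: contraTF xA => /eqP->; rewrite (disjointFl dAB yB).
case=> [a b1 b2 G aA b1B b2B nb CG | a1 a2 b G a1A a2A na bB CG].
  rewrite subsetD_set3 => /and4P[GABC aG b1G b2G].
  apply: sum4; try (apply: mem_elems; rewrite /index_triple subsetD_set2 aA ?b1B ?b2B /=).
  - by rewrite CG GABC aG.
  - rewrite (subset_trans CG (subsetUr _ _)) sub_in ?inE ?b1B ?orbT //.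
    by rewrite !negb_or aG b2G (neqAB a b1) // eq_sym nb.
  - by rewrite CG GABC aG.
  - rewrite (subset_trans CG (subsetUr _ _)) sub_in ?inE ?b2B ?orbT //.
    by rewrite !negb_or aG b1G (neqAB a b2) // nb.
  exact: elem_exchange_r.
rewrite subsetD_set3 => /and4P[GABC a1G a2G bG].
apply: sum4; try (apply: mem_elems; rewrite /index_triple subsetD_set2 bB ?a1A ?a2A /=).
- by rewrite CG GABC a1G.
- rewrite (subset_trans CG (subsetUr _ _)) sub_in ?inE ?a1A //.
  by rewrite !negb_or bG a2G (neqAB a1 b) // eq_sym na.
- by rewrite CG GABC a2G.
- rewrite (subset_trans CG (subsetUr _ _)) sub_in ?inE ?a2A //.
  by rewrite !negb_or bG a1G (neqAB a2 b) // na.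
by rewrite ![elem _ b _]semielemC; apply: elem_exchange_r.
Qed.

Lemma adjacent_fiber u v : adjacent u v -> u \in fiber A B C -> v \in fiber A B C.
Proof.
move=> adj; rewrite !inE => /eqP->; apply/eqP/subr0_eq; rewrite -sumrB.
pose d : {ffun elems A B C -> int} := [ffun z => (u z)%:Z - (v z)%:Z]%R.
have -> : (\sum_(z : elems A B C) (fsval z *+ u z - fsval z *+ v z) =
    \sum_z fsval z *~ d z)%R.
  by apply: eq_bigr => z _; rewrite ffunE mulrzBr.
case: adj => /basic_diff_value // eq0; apply: oppr_inj; rewrite oppr0 -sumrN.
by rewrite -[RHS]eq0; apply: eq_bigr => z _; rewrite [in RHS]ffunE mulrNz.
Qed.

Lemma fiber_grid (x0 : N) th : th \in fiber A B C -> exists col row,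
  [/\ forall j, perm_eq (col j) (enum A), forall i, perm_eq (row i) (enum B),
      compatible col row, forall j, #|B| <= j -> col j = col #|B| &
      th = grid_sum x0 A B grid_cell col row].
Proof.
rewrite inE => /eqP repr; have [t tP] := elems_index.
pose a u := (t u).1.1; pose b u := (t u).1.2; pose G u := (t u).2.
have abG u : index_triple A B C (a u) (b u) (G u) by have [] := tP u.
have valE u : fsval u = elem (a u) (b u) (G u) by have [] := tP u.
have reprG : semielem A B C = (\sum_u elem (a u) (b u) (G u) *+ th u)%R.
  by rewrite repr; apply: eq_bigr => u _; rewrite valE.
have [col [row [pc pr [on cov] comp eqc]]] := grid_exists x0 dAB dAC dBC abG reprG.
exists col, row; split=> //.
have valG u : fsval u = elem (a u) (b u) (G u :&: A :|: G u :&: B :|: C).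
  have [_ _ _ _ [_ _ _ _ GE]] := index_tripleP dAB dAC dBC (abG u).
  by rewrite valE; congr elem.
have cellP k l u :
    (a u, G u :&: A) = edge x0 (col l) k -> (b u, G u :&: B) = edge x0 (row k) l ->
    fsval u = elem (edge x0 (col l) k).1 (edge x0 (row k) l).1
      ((edge x0 (col l) k).2 :|: (edge x0 (row k) l).2 :|: C).
  by move=> <- <-; rewrite valG.
have ltAB u := index_triple_card dAB dAC dBC (abG u).
(* The index [v] of weight one covering the cell of [u] yields the same imset, and indices are
   imsets, so [u = v]. *)
have th01 u : 0 < th u -> th u = 1.
  move=> thu; have [eqa eqb] := on u thu; have [ltA ltB] := ltAB u.
  have [v [thv eqva eqvb]] := cov _ _ ltA ltB.
  suff -> : u = v by [].
  by apply: val_inj; rewrite /= (cellP _ _ u eqa eqb) (cellP _ _ v eqva eqvb).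
have cell_val (u : elems A B C) (k : 'I_#|A|) (l : 'I_#|B|) :
    grid_cell (edge x0 (col l) k) (edge x0 (row k) l) u =
    [&& th u == 1, #|G u :&: A| == k & #|G u :&: B| == l].
  rewrite ffunE; congr nat_of_bool; apply/idP/and3P.
    move=> /eqP eq_u.
    have [v [thv eqva eqvb]] := cov k l (ltn_ord k) (ltn_ord l).
    have -> : u = v by apply: val_inj; rewrite /= eq_u -(cellP k l v).
    have [[_ ->] [_ ->]] := (eqva, eqvb); rewrite thv eqxx.
    by rewrite (take_set_card (pc l)) ?(take_set_card (pr k)) // ltnW.
  move=> [/eqP thu /eqP ck /eqP cl]; have [|eqa eqb] := on u; first by rewrite thu.
  by rewrite ck cl in eqa eqb; apply/eqP/cellP.
apply/ffunP=> u; rewrite /grid_sum sum_ffunE.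
(* At [u] only the cell at the bidegree of [G u] can contribute to the double sum. *)
rewrite (eq_bigr (fun l : 'I_#|B| => \sum_(k < #|A|)
  ([&& th u == 1, #|G u :&: A| == k & #|G u :&: B| == l] : nat))%R); last first.
  by move=> l _; rewrite sum_ffunE; apply: eq_bigr => k _; rewrite cell_val.
have [thu | /th01 thu] := posnP (th u).
  by rewrite thu big1 // => l _; rewrite big1.
have [ltA ltB] := ltAB u; rewrite thu.
rewrite (bigD1 (Ordinal ltB)) //= (bigD1 (Ordinal ltA)) //= !eqxx !big1 //.
  move=> l; rewrite -val_eqE /= eq_sym => /negPf nl; rewrite big1 // => k _.
  by rewrite nl andbF.
by move=> k; rewrite -val_eqE /= eq_sym => /negPf->.
Qed.

Lemma fiber_linked th th' : th \in fiber A B C -> th' \in fiber A B C -> linked th th'.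
Proof.
(* A member of [elems] supplies the default element [x0]; if [elems] is empty, there is only one
   coefficient vector. *)
have [t _] := elems_index; case: (pickP (fun _ : elems A B C => true)) => [u _ | no_u].
  pose x0 := (t u).1.1.
  pose canon := grid_sum x0 A B grid_cell (fun=> enum A) (fun=> enum B).
  have canonP th0 : th0 \in fiber A B C -> linked th0 canon.
    move/(fiber_grid x0) => [col [row [pc pr comp eqc ->]]].
    apply: (canonical_grid (@rt1n_refl _ _) linked_trans linkedDl) => //.
    - exact: grid_cell_exchA.
    - exact: grid_cell_exchB.
    by exists #|B|.
  by move=> /canonP lth /canonP lth'; apply: linked_trans lth (linked_sym lth').
move=> _ _; suff -> : th = th' by apply: rt1n_refl.
by apply/ffunP=> u; have := no_u u.
Qed.

End Moves.

Theorem theorem1 (N : finType) (A B C : {set N})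
  (dAB : [disjoint A & B]) (dAC : [disjoint A & C]) (dBC : [disjoint B & C])
  (th th' : coefs A B C)
  (fth : th \in fiber A B C) (fth' : th' \in fiber A B C) :
  exists (K : nat) (p : nat -> coefs A B C),
    [/\ p 0 = th, p K = th',
        forall k : nat, k <= K -> p k \in fiber A B C
      & forall k : nat, 1 <= k <= K -> adjacent (p k.-1) (p k)].
Proof.
have lk := fiber_linked dAB dAC dBC fth fth'; move: fth => {fth'}.
elim: lk => [x | x y z xy _ IH] xF.
  by exists 0, (fun=> x); split=> // -[].
(* Membership in the fiber is passed along the chain from each vector to the next. *)
have [K [p [p0 pK pF adj]]] := IH (adjacent_fiber dAB xy xF).
exists K.+1, (fun k => if k is k'.+1 then p k' else x); split=> // [[|k] // | [|[|k]] //].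
- exact: pF.
- by rewrite /= p0.
exact: (adj k.+1).
Qed.
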